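(* The set of positive integers $n$ such that $v_n$ is divisible by the least common multiple of $1, 2, \dots, \lfloor n^{1/4} \rfloor$ has asymptotic density one; that is, if $A$ denotes this set, then $\lim_{x\to\infty} |A\cap[1,x]|/x = 1$.
   Context: For a positive integer $n$, let $H_n = 1+\frac12+\frac13+\cdots+\frac1n$ be the $n$-th harmonic number, written in lowest terms as $H_n = u_n/v_n$ with $u_n, v_n$ integers, $\gcd(u_n,v_n)=1$ and $v_n>0$. Here $\lfloor y\rfloor$ denotes the greatest integer not exceeding the real number $y$. *)

(* Defs.v *)
From HB Require Import structures.
From mathcomp Require Import all_boot all_order all_algebra finmap.
From mathcomp Require Import all_classical all_reals all_analysis.

Set Implicit Arguments.
Unset Strict Implicit.
Unset Printing Implicit Defensive.

Import Order.TTheory GRing.Theory Num.Theory.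
Import numFieldNormedType.Exports.

Local Open Scope classical_set_scope.
Local Open Scope ring_scope.

Definition harmonic_number (n : nat) : rat := \sum_(1 <= k < n.+1) k%:R^-1.

(* [denq] is the positive denominator of the reduced fraction. *)
Definition harmonic_den (n : nat) : int := denq (harmonic_number n).

Definition lcm_upto (m : nat) : nat := \big[lcmn/1%N]_(1 <= k < m.+1) k.

(* [Num.truncn] is the nat-valued floor of a nonnegative real. *)
Definition floor_root4 (R : realType) (n : nat) : nat :=
  Num.truncn ((n%:R : R) `^ 4^-1).

Definition lcm_dvd_harmonic_den (R : realType) : set nat :=
  [set n | (0 < n)%N /\
           ((lcm_upto (floor_root4 R n))%:Z %| harmonic_den n)%Z].

(* The set being counted is finite for every x, so [fset_set] (which sends
   infinite sets to the empty set) keeps all of its elements. *)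
Definition count_upto (R : realType) (A : set nat) (x : R) : nat :=
  #|` fset_set (A `&` [set n | (1 <= n)%N /\ n%:R <= x]) |%fset.

Definition has_asymptotic_density (R : realType) (A : set nat) (d : R) : Prop :=
  (count_upto A x)%:R / x @[x --> +oo] --> d.

(* Main.v *)
Require Import Defs.
From mathcomp Require Import all_boot all_order all_algebra finmap.
From mathcomp Require Import all_classical all_reals all_analysis.
From mathcomp Require Import zify ring lra.

(** Write [H_n] for the harmonic numbers and let [J_p] be the set of indices [m]
    such that [p] divides the reduced numerator of [H_m].

    Splitting [H_n] along the multiples of [p ^ a] gives
    [H_n = H_m / p ^ a + S] with [m = n %/ p ^ a], where every denominator in [S]
    has [p]-adic valuation less than [a].  Hence if [p ^ a] does not divide the
    denominator of [H_n], then [m] lies in [J_p]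
    ([divides_harmonic_num_of_den]).  Let [T ^ 4 <= N < (T + 1) ^ 4] and let
    [p ^ A] be the largest power of [p] up to [T].  The indices [n <= N] that
    violate the divisibility all satisfy [n %/ p ^ A \in J_p] for some prime
    [p <= T]; it suffices to bound, for each [p], the number [B_p] of such [n],
    and to show that the sum of the [B_p] is [o(N)].

    The set [J_p] is thin.  It is stable under [m |-> m %/ p], so its members are
    built digit by digit in base [p].  For a fixed prefix [m], if the digits [r]
    and [r + d] are both allowed, then [r] is a root modulo [p] of the derivative
    of [(X + 1) ... (X + d)], a nonzero polynomial of degree [d - 1].  So gaps
    of length less than [D] occur at most [D ^ 2] times, and with
    [D ~ p ^ (1/3)] there are [O(p ^ (2/3))] allowed digits
    ([cnt_block_cube]).  With [k] digits this gives
    [#(J_p up to Y) <= C ^ k * Y ^ (2/3)] ([cnt_cube]), whence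
    [B_p <= C ^ k * p ^ (A/3) * N ^ (2/3) <= C ^ k * N ^ (3/4)].

    The primes are then split into three ranges.
    - For [p ^ 2 > T] the number of digits is bounded, so [B_p = O(N ^ (3/4))],
      and there are [o(T) = o(N ^ (1/4))] primes up to [T].  The total is [o(N)]
      only because primes have density zero, which follows from the bound
      [4 ^ n] for the product of the primes up to [n].
    - For [p ^ 2 <= T] and [p] above a constant, [C ^ k] costs a small power of
      [N], and there are only [O(N ^ (1/8))] such primes.
    - For each of the finitely many remaining primes, [J_p] has density zero,
      because the digits [0] and [1] are never both allowed. *)

Set Implicit Arguments.
Unset Strict Implicit.
Unset Printing Implicit Defensive.

Import Order.TTheory GRing.Theory Num.Theory.
Import numFieldNormedType.Exports.

(** * Reduction of rational numbers modulo a prime *)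

Local Open Scope ring_scope.

(** The reduction map from [p]-integral rationals to ['F_p], as a relation: any
    fraction whose denominator is prime to [p] computes it, so sums and
    products need no normalization.  The existence of a reduction expresses
    [p]-integrality. *)
Definition reduces (p : nat) (q : rat) (t : 'F_p) : Prop :=
  exists a b : int,
    [/\ (b%:~R : 'F_p) != 0, q = a%:~R / b%:~R & t = a%:~R / b%:~R].

Section Reduction.
Variables (p : nat) (pP : prime p).

Lemma Fp_nat_eq0 (n : nat) : ((n%:R : 'F_p) == 0) = (p %| n)%N.
Proof. by rewrite -(dvdn_pcharf (pchar_Fp pP)). Qed.

Lemma Fp_int_neq0 (b : int) : (b%:~R : 'F_p) != 0 -> (b%:~R : rat) != 0.
Proof. by rewrite intr_eq0; apply: contraNneq => ->. Qed.

Lemma reducesD (q r : rat) (s t : 'F_p) :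
  reduces q s -> reduces r t -> reduces (q + r) (s + t).
Proof.
move=> [a [b [b0 -> ->]]] [c [d [d0 -> ->]]].
exists (a * d + c * b), (b * d); rewrite !rmorphD !rmorphM mulf_neq0 //.
by split=> //; rewrite addf_div // Fp_int_neq0.
Qed.

Lemma reducesN (q : rat) (s : 'F_p) : reduces q s -> reduces (- q) (- s).
Proof.
by move=> [a [b [b0 -> ->]]]; exists (- a), b; rewrite !rmorphN !mulNr.
Qed.

Lemma reducesM (q r : rat) (s t : 'F_p) :
  reduces q s -> reduces r t -> reduces (q * r) (s * t).
Proof.
move=> [a [b [b0 -> ->]]] [c [d [d0 -> ->]]].
exists (a * c), (b * d); rewrite !rmorphM mulf_neq0 //.
by split=> //; rewrite mulf_div.
Qed.

Lemma reduces_uniq (q : rat) (s t : 'F_p) : reduces q s -> reduces q t -> s = t.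
Proof.
move=> [a [b [b0 -> ->]]] [c [d [d0 /eqP + ->]]].
rewrite eqr_div ?Fp_int_neq0 // -!rmorphM eqr_int => /eqP adcb.
by apply/eqP; rewrite eqr_div // -!rmorphM adcb.
Qed.

Lemma reduces_nat (n : nat) : @reduces p n%:R n%:R.
Proof. by exists n%:Z, 1; rewrite !divr1 oner_eq0. Qed.

Lemma reduces_natV (n : nat) : ~~ (p %| n)%N -> @reduces p n%:R^-1 n%:R^-1.
Proof. by move=> pn; exists 1, n%:Z; rewrite !mul1r Fp_nat_eq0. Qed.

Lemma reduces_sum (I : Type) (r : seq I) (P : pred I) (f : I -> rat)
    (g : I -> 'F_p) :
  (forall i, P i -> reduces (f i) (g i)) ->
  reduces (\sum_(i <- r | P i) f i) (\sum_(i <- r | P i) g i).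
Proof.
move=> fg; apply: (big_ind2 (fun x y => @reduces p x y)) => //.
- exact: (reduces_nat 0).
- by move=> ? ? ? ? ? ?; exact: reducesD.
Qed.

(** The power of [p] in [d] is at most [p ^ j], hence cancels against the factor
    [p ^ j]. *)
Lemma reduces_expM_div (j : nat) (a : int) (d : nat) :
  ~~ (p ^ j.+1 %| d)%N ->
  exists t, @reduces p ((p ^ j)%N%:R * (a%:~R / d%:R)) t.
Proof.
move=> pd.
have d0 : (0 < d)%N by case: d pd => //; rewrite dvdn0.
have [m cpm dE] := pfactor_coprime pP d0.
have lj : (logn p d <= j)%N.
  by rewrite leqNgt; apply: contra pd => lj; rewrite dE dvdn_mull // dvdn_exp2l.
have pm : ~~ (p %| m)%N by rewrite -prime_coprime.
have m0 : (m%:R : rat) != 0.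
  by rewrite pnatr_eq0; apply: contraNneq pm => ->; rewrite dvdn0.
have p0 : (p%:R : rat) != 0 by rewrite pnatr_eq0 -lt0n prime_gt0.
exists ((p ^ (j - logn p d))%N%:R * (a%:~R / m%:R)).
have -> : (p ^ j)%N%:R * (a%:~R / d%:R) =
    (p ^ (j - logn p d))%N%:R * (a%:~R / m%:R) :> rat.
  have -> : (d%:R : rat) = m%:R * (p ^ logn p d)%N%:R by rewrite -natrM -dE.
  rewrite -{1}(subnK lj) expnD natrM.
  have : ((p ^ logn p d)%N%:R : rat) != 0 by rewrite natrX expf_neq0.
  move: ((p ^ logn p d)%N%:R) ((p ^ (j - logn p d))%N%:R) m%:R m0 => x y z z0 x0.
  by field; rewrite z0.
apply: reducesM (reduces_nat _) _.
by exists a, m%:Z; rewrite Fp_nat_eq0.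
Qed.

End Reduction.

(** * Base-p digits of the indices whose harmonic numerator is divisible by p *)

(** Since [H_0 = 0], the index [0] belongs to the set, so quotients [n %/ p ^ j]
    that vanish need no separate treatment. *)
Definition divides_harmonic_num (p n : nat) : bool :=
  (p %| numq (harmonic_number n))%Z.

Section HarmonicDigits.
Variables (p : nat) (pP : prime p).

Notation J := (divides_harmonic_num p).

Lemma prime_dvd_num_not_den (x : rat) :
  (p %| numq x)%Z -> ~~ (p %| denq x)%Z.
Proof.
move=> pnum; apply/negP => pden.
have := coprime_num_den x; rewrite /coprime => /eqP g1.
have : (p %| gcdn `|numq x| `|denq x|)%N.
  by move: pnum pden; rewrite dvdn_gcd !dvdzE absz_nat => -> ->.
by rewrite g1 dvdn1 => /eqP p1; move: pP; rewrite p1.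
Qed.

Lemma divides_harmonic_numP n :
  reflect (@reduces p (harmonic_number n) 0) (J n).
Proof.
rewrite /divides_harmonic_num.
set h := harmonic_number n.
have den0 : ((denq h)%:~R : rat) != 0 by rewrite intr_eq0 denq_neq0.
rewrite (dvdz_pcharf (pchar_Fp pP)); apply: (iffP eqP) => [n0|].
  exists (numq h), (denq h); rewrite n0 mul0r divq_num_den; split=> //.
  apply/negP => d0.
  have := @prime_dvd_num_not_den h.
  by rewrite !(dvdz_pcharf (pchar_Fp pP)) n0 d0 eqxx => /(_ isT).
move=> [a [b [b0 hE /esym/eqP]]].
rewrite mulf_eq0 invr_eq0 (negbTE b0) orbF => /eqP a0.
move/eqP: hE; rewrite -{1}(divq_num_den h).
rewrite eqr_div ?(Fp_int_neq0 b0) // -!rmorphM eqr_int => /eqP E.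
have : ((numq h * b)%:~R : 'F_p) = 0 by rewrite E intrM a0 mul0r.
by move/eqP; rewrite intrM mulf_eq0 (negbTE b0) orbF => /eqP.
Qed.

Lemma harmonic_numberS n :
  harmonic_number n.+1 = harmonic_number n + n.+1%:R^-1.
Proof. by rewrite /harmonic_number big_nat_recr. Qed.

Lemma harmonic_numberD m n :
  harmonic_number (m + n) =
  harmonic_number m + \sum_(0 <= i < n) (m + i.+1)%:R^-1.
Proof.
elim: n => [|n IH]; first by rewrite addn0 big_geq // addr0.
by rewrite addnS harmonic_numberS IH big_nat_recr //= addrA addnS.
Qed.

(** The terms of [H_n] at the multiples of [d] add up to [H_(n %/ d) / d]. *)
Lemma harmonic_number_split d n : (0 < d)%N ->
  harmonic_number n = harmonic_number (n %/ d) / d%:R +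
    \sum_(1 <= k < n.+1 | ~~ (d %| k)%N) k%:R^-1.
Proof.
move=> d0; elim: n => [|n IH].
  by rewrite div0n /harmonic_number !big_geq // mul0r addr0.
rewrite harmonic_numberS IH [in RHS]big_mkcond big_nat_recr //= -big_mkcond /=.
rewrite divnS //.
have [dn|dn] := boolP (d %| n.+1)%N; last by rewrite addrA add0n.
rewrite add1n harmonic_numberS mulrDl -!addrA; congr (_ + _).
rewrite addr0 addrC; congr (_ + _).
have <- : ((n %/ d).+1 * d)%N = n.+1.
  by rewrite -[RHS](divnK dn) divnS // dn.
by rewrite natrM invfM.
Qed.

(** In the splitting of [H_n] along the multiples of [p ^ j.+1], multiplied by
    [p ^ j.+1], both [H_n] and the sum over the other terms become [p] times a
    [p]-integral number, so the same holds for [H_(n %/ p ^ j.+1)]. *)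
Lemma divides_harmonic_num_of_den j n :
  ~~ ((p ^ j.+1)%N%:Z %| harmonic_den n)%Z -> J (n %/ p ^ j.+1).
Proof.
move=> pd; apply/divides_harmonic_numP.
have P0 : (0 < p ^ j.+1)%N by rewrite expn_gt0 prime_gt0.
have := harmonic_number_split n P0.
set h := harmonic_number n; set hq := harmonic_number (n %/ _).
set S := \sum_(_ <= _ < _ | _) _ => hE.
have denE : (denq h)%:~R = (`|denq h|%N)%:R :> rat.
  by rewrite -[in LHS](gtz0_abs (denq_gt0 h)).
have [t ht] : exists t, @reduces p ((p ^ j)%N%:R * h) t.
  rewrite -[h]divq_num_den denE; exact: reduces_expM_div.
have [s hs] : exists s, @reduces p ((p ^ j)%N%:R * S) s.
  pose g k : 'F_p := xget 0 (fun s => reduces ((p ^ j)%N%:R * k%:R^-1) s).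
  exists (\sum_(1 <= k < n.+1 | ~~ (p ^ j.+1 %| k)%N) g k).
  rewrite /S mulr_sumr; apply: reduces_sum => // k pk.
  have [s hs] := reduces_expM_div pP 1 pk.
  by rewrite mul1r in hs; rewrite /g; exact: (xgetI 0 hs).
have -> : hq = p%:R * ((p ^ j)%N%:R * h + - ((p ^ j)%N%:R * S)).
  rewrite hE expnS natrM.
  have : (p%:R : rat) != 0 by rewrite pnatr_eq0 -lt0n prime_gt0.
  have : ((p ^ j)%N%:R : rat) != 0 by rewrite pnatr_eq0 -lt0n expn_gt0 prime_gt0.
  by move: p%:R ((p ^ j)%N%:R) => x y y0 x0; field; rewrite ?x0 ?y0.
have -> : (0 : 'F_p) = p%:R * (t - s) by rewrite (pchar_Fp_0 pP) mul0r.
apply: reducesM; last exact: (reducesD ht (reducesN hs)). exact: reduces_nat.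
Qed.

(** A number whose numerator is divisible by [p] has a denominator prime to [p],
    so this is the preceding lemma with exponent [1]. *)
Lemma divides_harmonic_num_div n : J n -> J (n %/ p).
Proof.
move=> Jn; have := @divides_harmonic_num_of_den 0 n; rewrite expn1; apply.
exact: prime_dvd_num_not_den.
Qed.

(** Within a block [[p * m, p * m + p)] the differences of harmonic numbers are
    [p]-integral, and modulo [p] they do not depend on [m]. *)
Lemma sum_inv_eq0_of_gap m r d : (r + d < p)%N ->
  J (p * m + r) -> J (p * m + (r + d)) ->
  \sum_(0 <= i < d) (r + i.+1)%:R^-1 = 0 :> 'F_p.
Proof.
move=> rd /divides_harmonic_numP Jr /divides_harmonic_numP.
rewrite addnA harmonic_numberD; set S := \sum_(_ <= _ < _) _ => Jrd.
have S0 : @reduces p S 0.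
  have := reducesD Jrd (reducesN Jr).
  by rewrite addrAC subrr add0r subr0.
apply: (reduces_uniq _ S0).
rewrite /S !big_nat; apply: reduces_sum => // i /andP[_ id_].
have E : ((p * m + r + i.+1)%:R : 'F_p) = (r + i.+1)%:R.
  by rewrite -addnA natrD natrM (pchar_Fp_0 pP) mul0r add0r.
rewrite -E; apply: reduces_natV => //.
by rewrite -(Fp_nat_eq0 pP) E (Fp_nat_eq0 pP) gtnNdvd //; lia.
Qed.

End HarmonicDigits.

(** * The polynomials that detect two allowed digits at a given distance *)

Section GapPolynomial.
Variables (p : nat) (pP : prime p).

Definition gap_poly (d : nat) : {poly 'F_p} :=
  \prod_(0 <= i < d) ('X - (- i.+1%:R)%:P).

Lemma size_gap_poly d : size (gap_poly d) = d.+1.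
Proof. by rewrite size_prod_XsubC size_iota subn0. Qed.

Lemma gap_polyS d :
  gap_poly d.+1 = gap_poly d * ('X - (- d.+1%:R)%:P).
Proof. by rewrite /gap_poly big_nat_recr. Qed.

Lemma horner_deriv_gap_poly d (r : 'F_p) :
  (forall i, (i < d)%N -> r + i.+1%:R != 0) ->
  (gap_poly d)^`().[r] =
    (gap_poly d).[r] * \sum_(0 <= i < d) (r + i.+1%:R)^-1.
Proof.
elim: d => [|d IH] r0.
  by rewrite /gap_poly !big_geq // derivC hornerC mulr0.
rewrite gap_polyS derivM derivXsubC mulr1 hornerD !hornerM.
rewrite IH => [|i id_]; last exact/r0/ltnW.
rewrite !hornerXsubC opprK big_nat_recr //=.
have := r0 d (ltnSn d); move: (r + d.+1%:R) => x x0.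
by rewrite mulrDr mulrAC mulfK.
Qed.

Lemma deriv_gap_poly_neq0 d : (0 < d < p)%N -> (gap_poly d)^`() != 0.
Proof.
move=> /andP[d0 dp]; apply/eqP => /(congr1 (fun q : {poly _} => q`_d.-1)).
rewrite coef_deriv coef0 prednK //.
have /monicP : gap_poly d \is monic by exact: monic_prod_XsubC.
rewrite /lead_coef size_gap_poly /= => -> /eqP.
by rewrite (Fp_nat_eq0 pP) gtnNdvd.
Qed.

(** Such an [r] is a root modulo [p] of the derivative of [gap_poly d], whose
    logarithmic derivative at [r] is the difference of the two harmonic
    numbers; this derivative has degree less than [d] and, as [d < p], leading
    coefficient [d != 0]. *)
Lemma count_gap m d : (0 < d)%N ->
  (count (fun r => [&& (r + d < p)%N, divides_harmonic_num p (p * m + r) &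
                      divides_harmonic_num p (p * m + (r + d))])
     (iota 0 p) <= d)%N.
Proof.
move=> d0; set P := fun r => _.
have [dp|pd] := ltnP d p; last first.
  rewrite (@eq_in_count _ _ pred0) ?count_pred0 // => r _ /=.
  by apply/negP => /andP[]; lia.
pose rs := [seq (r%:R : 'F_p) | r <- iota 0 p & P r].
have injN : {in iota 0 p &, injective (fun r => r%:R : 'F_p)}.
  move=> a b; rewrite !mem_iota /= !add0n => ap bp.
  wlog ab : a b ap bp / (a <= b)%N.
    by move=> H; case/orP: (leq_total a b) => ?; [|move/esym]; move/H => ->.
  move/eqP; rewrite eq_sym -subr_eq0 -natrB // (Fp_nat_eq0 pP).
  have [|pos] := posnP (b - a); first by lia.
  by rewrite gtnNdvd //; lia.
have urs : uniq rs.
  rewrite map_inj_in_uniq ?filter_uniq ?iota_uniq // => a b.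
  rewrite !mem_filter => /andP[_ ap] /andP[_ bp]; exact: injN.
have roots : all (root (gap_poly d)^`()) rs.
  apply/allP => _ /mapP[r + ->]; rewrite mem_filter => /andP[/and3P[rdp Jr Jrd] _].
  rewrite rootE horner_deriv_gap_poly => [|i id_].
    apply/eqP; rewrite -[RHS](mulr0 (gap_poly d).[r%:R]); congr (_ * _).
    apply: etrans (sum_inv_eq0_of_gap pP rdp Jr Jrd).
    by apply: eq_bigr => i _; rewrite natrD.
  by rewrite -natrD (Fp_nat_eq0 pP) gtnNdvd //; lia.
rewrite -size_filter -(size_map (fun r => r%:R : 'F_p)) -/rs -ltnS.
apply: (leq_trans (max_poly_roots (deriv_gap_poly_neq0 _) roots urs)).
  by rewrite d0.
have := lt_size_deriv (p := gap_poly d); rewrite size_gap_poly => H.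
by apply/ltnW/H; rewrite -size_poly_gt0 size_gap_poly.
Qed.

End GapPolynomial.

(** * Counting natural numbers below a bound *)

Section Counting.
Local Open Scope nat_scope.

Definition cnt (P : pred nat) (N : nat) : nat := count P (iota 0 N).

Lemma leq_cnt (P Q : pred nat) N :
  (forall n, n < N -> P n -> Q n) -> cnt P N <= cnt Q N.
Proof.
move=> PQ; rewrite /cnt -!sum1_count [leqLHS]big_mkcond [leqRHS]big_mkcond /=.
rewrite big_seq [leqRHS]big_seq; apply: leq_sum => n.
by rewrite mem_iota add0n => /= nN; case: ifP => // /(PQ _ nN) ->.
Qed.

Lemma cnt_monotone P M N : M <= N -> cnt P M <= cnt P N.
Proof. by move=> MN; rewrite /cnt -(subnKC MN) iotaD count_cat leq_addr. Qed.

Lemma cnt_leq P N : cnt P N <= N.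
Proof. by rewrite -[leqRHS](size_iota 0) count_size. Qed.

Lemma cntU (P Q : pred nat) N :
  cnt (fun n => P n || Q n) N <= cnt P N + cnt Q N.
Proof. by rewrite /cnt -count_predUI leq_addr. Qed.

Lemma cnt_has (I : Type) (s : seq I) (P : I -> pred nat) N :
  cnt (fun n => has (P^~ n) s) N <= \sum_(i <- s) cnt (P i) N.
Proof.
elim: s => [|i s IH]; first by rewrite big_nil /cnt count_pred0.
by rewrite big_cons; apply: leq_trans (cntU _ _ _) _; rewrite leq_add2l.
Qed.

Lemma cnt_inj (P : pred nat) (f : nat -> nat) N M :
  (forall n, n < N -> P n -> f n < M) ->
  (forall a b, a < b < N -> P a -> P b -> f a <> f b) ->
  cnt P N <= M.
Proof.
move=> fM finj; rewrite /cnt -size_filter -(size_map f) -[M](size_iota 0).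
apply: uniq_leq_size => [|_ /mapP[n + ->]].
  rewrite map_inj_in_uniq ?filter_uniq ?iota_uniq // => a b.
  rewrite !mem_filter !mem_iota !add0n /= => /andP[Pa aN] /andP[Pb bN] fab.
  have [ab|ba|//] := ltngtP a b.
    by case: (finj a b); rewrite ?ab.
  by case: (finj b a); rewrite ?ba.
rewrite mem_filter !mem_iota !add0n /= => /andP[Pn nN]; exact: fM.
Qed.

Lemma cnt_block (P Q : pred nat) d M K :
  (forall m, cnt (fun r => P (d * m + r)) d <= M) ->
  (forall m r, r < d -> P (d * m + r) -> Q m) ->
  cnt P (d * K) <= M * cnt Q K.
Proof.
move=> PM PQ; elim: K => [|K IH]; first by rewrite muln0.
rewrite mulnS addnC /cnt iotaD count_cat -(addn1 K) iotaD count_cat mulnDr !add0n.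
rewrite leq_add //= addn0 -[X in iota X d]addn0 iotaDl count_map.
have [QK|/negP nQ] := boolP (Q K).
  by rewrite muln1; exact: PM.
rewrite muln0 leqn0 (@eq_in_count _ _ pred0) ?count_pred0 // => r.
by rewrite mem_iota /= => rd; apply/negP => /(PQ _ _ rd).
Qed.

End Counting.

(** * Allowed last digits *)

Section BlockCount.
Local Open Scope nat_scope.
Variables (p : nat) (pP : prime p).
Notation J := (divides_harmonic_num p).

(** Elements of the block followed by another one at distance [d < D] are
    roots of one of [D] polynomials of degree less than [D]; the remaining
    ones lie in distinct intervals [[D i, D i + D)]. *)
Lemma cnt_block_gap m z D : 0 < D -> z <= p ->
  cnt (fun r => J (p * m + r)) z <= D * D + (z %/ D).+1.
Proof.
move=> D0 zp.
pose near d r := [&& r + d < p, J (p * m + r) & J (p * m + (r + d))].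
(* The window is cut at [z] here, so that only elements below [z] are compared;
   [near] may count all of the block. *)
pose far r := J (p * m + r) &&
  all (fun d => (r + d < z) ==> ~~ J (p * m + (r + d))) (iota 1 D.-1).
have H : cnt (fun r => J (p * m + r)) z <=
    cnt (fun r => has (near^~ r) (iota 1 D.-1)) z + cnt far z.
  apply: leq_trans (cntU _ _ _); apply: leq_cnt => r rz Jr.
  have [//|/hasPn nn] := boolP (has _ _).
  rewrite /far Jr /=; apply/allP => d dD; apply/implyP => rdz.
  by have := nn d dD; rewrite /near Jr (leq_trans rdz zp).
apply: leq_trans H _; apply: leq_add.
  apply: leq_trans (cnt_monotone _ zp) _; apply: leq_trans (cnt_has _ _ _) _.
  apply: (@leq_trans (\sum_(d <- iota 1 D.-1) D)).
    rewrite big_seq [leqRHS]big_seq; apply: leq_sum => d.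
    rewrite mem_iota => dD; apply: (@leq_trans d); last by lia.
    by apply: count_gap => //; lia.
  by rewrite big_const_seq count_predT size_iota iter_addn_0 leq_mul2l leq_pred orbT.
apply: (cnt_inj (f := fun r => r %/ D)) => [r rz _|].
  by rewrite ltnS leq_div2r // ltnW.
move=> a b /andP[ab bz] /andP[_ /allP fa] /andP[Jb _] E.
have bD : b - a < D.
  by have := divn_eq a D; have := divn_eq b D; rewrite E;
     have := ltn_pmod a D0; have := ltn_pmod b D0; lia.
have := fa (b - a); rewrite mem_iota subnKC ?(ltnW ab) // bz Jb /=.
by move=> /(_ _)/negP; apply; lia.
Qed.

Lemma root_ex n z : 0 < n -> exists D, D ^ n <= z < D.+1 ^ n.
Proof.
move=> n0; have ub D : D ^ n <= z -> D <= z.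
  by apply: leq_trans; case: D => // D; rewrite -[leqLHS]expn1 leq_pexp2l.
have ex : exists D, D ^ n <= z by exists 0; rewrite exp0n.
have := ex_maxnP ex ub; case: ex_maxnP => D Dn Dmax _.
by exists D; rewrite Dn ltnNge; apply/negP => /Dmax; rewrite ltnn.
Qed.

(** The choice [D ~ z ^ (1/3)] balances the two terms of [cnt_block_gap]; their
    sum is then at most [D ^ 2 + 8 D ^ 2 + 1 <= 10 D ^ 2]. *)
Lemma cnt_block_cube m z : 0 < z <= p ->
  cnt (fun r => J (p * m + r)) z ^ 3 <= 1000 * z ^ 2.
Proof.
move=> /andP[z0 zp]; have [D /andP[D3 zD]] := @root_ex 3 z isT.
have D0 : 0 < D by case: D zD {D3} => //; rewrite exp1n; lia.
have := cnt_block_gap m D0 zp.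
have : z %/ D <= 8 * D ^ 2.
  rewrite -ltnS ltn_divLR //; apply: (leq_trans zD).
  by rewrite !expnS !expn0; nia.
move: (z %/ D) (cnt _ _) => q c qD cD.
have c10 : c <= 10 * D ^ 2 by move: qD cD; rewrite !expnS !expn0; nia.
apply: (@leq_trans ((10 * D ^ 2) ^ 3)); first by rewrite leq_exp2r.
rewrite expnMn -expnM mulnC (mulnC 1000) leq_mul //.
by rewrite mulnC expnM leq_exp2r.
Qed.

(** [H_(p m + 1)] and [H_(p m)] differ by [1 / (p m + 1)], which is nonzero modulo
    [p], so the digits [0] and [1] are never both allowed. *)
Lemma cnt_block_lt m : cnt (fun r => J (p * m + r)) p <= p.-1.
Proof.
have p1 := prime_gt1 pP.
have [J0|J0] := boolP (J (p * m + 0)).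
  have J1 : ~~ J (p * m + 1).
    apply/negP => J1; have := @sum_inv_eq0_of_gap p pP m 0 1 p1 J0 J1.
    by rewrite big_nat1 add0n => /eqP; rewrite invr_eq0 oner_eq0.
  rewrite -[p in cnt _ p](subnKC p1) /cnt iotaD count_cat /= J0 (negbTE J1) !add0n.
  by have := count_size (fun r => J (p * m + r)) (iota 2 (p - 2)); rewrite size_iota; lia.
rewrite -[p in cnt _ p](subnKC (ltnW p1)) /cnt iotaD count_cat /= (negbTE J0) !add0n.
by have := count_size (fun r => J (p * m + r)) (iota 1 (p - 1)); rewrite size_iota; lia.
Qed.

End BlockCount.

Local Open Scope nat_scope.

(** * Members up to a bound, digit by digit *)

Section DigitCount.
Variables (p : nat) (pP : prime p).
Notation J := (divides_harmonic_num p).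

(** Deleting the last base-[p] digit of a member gives a member. *)
Lemma cnt_digit M Y : (forall m, cnt (fun r => J (p * m + r)) p <= M) ->
  cnt J Y.+1 <= M * cnt J (Y %/ p).+1.
Proof.
move=> JM; apply: leq_trans (cnt_block (Q := J) _ JM _).
  by apply: cnt_monotone; rewrite mulnC ltn_ceil // prime_gt0.
move=> m r rp /(divides_harmonic_num_div pP).
by rewrite mulnC divnMDl ?prime_gt0 // divn_small // addn0.
Qed.

Lemma expn_digit_div k Y : p ^ k.+1 <= Y < p ^ k.+2 ->
  p ^ k <= Y %/ p < p ^ k.+1.
Proof.
by rewrite leq_divRL ?ltn_divLR ?prime_gt0 // -!expnSr.
Qed.

Lemma cnt_sparse k Y : p ^ k <= Y < p ^ k.+1 -> cnt J Y.+1 <= p * p.-1 ^ k.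
Proof.
elim: k Y => [|k IH] Y.
  by rewrite muln1 => /andP[_ Yp]; exact: leq_trans (cnt_leq _ _) Yp.
move=> /expn_digit_div /IH H; apply: leq_trans (cnt_digit Y (cnt_block_lt pP)) _.
by rewrite expnS mulnCA leq_mul2l H orbT.
Qed.

Lemma bernoulli_pred q k : q ^ k * (k + q) <= q * q.+1 ^ k.
Proof.
elim: k => [|k IH]; first by rewrite !expn0; lia.
have : q ^ k <= q.+1 ^ k by case: k {IH} => // k; rewrite leq_exp2r.
rewrite !expnS; move: (q ^ k) (q.+1 ^ k) IH => a b; nia.
Qed.

(** Bernoulli's inequality turns the gain [((p - 1) / p) ^ k] over [k] digits
    into a factor [1 / k], which suffices for density zero. *)
Lemma cnt_sparse_log k Y : p ^ k <= Y < p ^ k.+1 -> k * cnt J Y.+1 <= p ^ 2 * Y.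
Proof.
move=> kY; have := cnt_sparse kY; have := bernoulli_pred p.-1 k.
rewrite prednK ?prime_gt0 //; case/andP: kY => + _.
move: (p.-1 ^ k) (p ^ k) (cnt _ _) (leq_pred p) => a b c.
rewrite !expnS expn0 muln1 => pp bY ab ca.
apply: (@leq_trans (k * (p * a))); first by rewrite leq_mul2l ca orbT.
rewrite mulnCA -mulnA leq_mul2l; apply/orP; right.
apply: (@leq_trans (p.-1 * b)); first by nia.
exact: leq_mul.
Qed.

(** Each digit after the first has at most [(K * p ^ 2) ^ (1/3)] choices.  The
    first digit is at most [z = Y %/ p ^ k], and the hypothesis for the window
    [z + 1 <= 2 z] instead of [p] keeps the bound proportional to
    [Y ^ (2/3)]. *)
Lemma cnt_cube K k Y :
  (forall m z, 0 < z <= p -> cnt (fun r => J (p * m + r)) z ^ 3 <= K * z ^ 2) ->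
  p ^ k <= Y < p ^ k.+1 -> cnt J Y.+1 ^ 3 <= 4 * K ^ k.+1 * Y ^ 2.
Proof.
move=> JK; elim: k Y => [|k IH] Y.
  rewrite expn0 expn1 => /andP[Y0 Yp].
  have := JK 0 Y.+1; rewrite muln0 Yp => /(_ isT) H.
  apply: leq_trans H _; rewrite expn1 -mulnA mulnCA leq_mul2l; apply/orP; right.
  by rewrite !expnS !expn0; nia.
move=> kY; have p0 := prime_gt0 pP.
have [M /andP[M3 ltM]] := @root_ex 3 (K * p ^ 2) isT.
have JM m : cnt (fun r => J (p * m + r)) p <= M.
  by rewrite -ltnS -(@ltn_exp2r _ _ 3) //; apply: leq_ltn_trans ltM; rewrite JK ?p0 /=.
have := leq_exp2r (cnt J Y.+1) (M * cnt J (Y %/ p).+1) (isT : 0 < 3).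
rewrite cnt_digit // => /leq_trans; apply.
rewrite expnMn; apply: leq_trans (leq_mul M3 (IH _ (expn_digit_div kY))) _.
have : (p * (Y %/ p)) ^ 2 <= Y ^ 2 by rewrite leq_exp2r // mulnC leq_divM.
rewrite expnMn (expnS K k.+1).
move: (p ^ 2) ((Y %/ p) ^ 2) (Y ^ 2) (K ^ k.+1) => a b c d abc.
have -> : K * a * (4 * d * b) = 4 * (K * d) * (a * b) by lia.
by rewrite leq_mul2l abc orbT.
Qed.

End DigitCount.

(** * The primes have density zero *)

Section Primorial.

Definition primorial n := \prod_(0 <= p < n.+1 | prime p) p.

Lemma prod_primes_dvd (r : seq nat) N :
  uniq r -> all prime r -> all (fun p => p %| N) r -> \prod_(p <- r) p %| N.
Proof.
elim: r => [|p r IH] /=; first by rewrite big_nil dvd1n.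
move=> /andP[pr ur] /andP[pP rP] /andP[pN rN].
rewrite big_cons Gauss_dvd ?pN ?IH //.
rewrite prime_coprime // big_seq; apply/negP.
elim/big_ind : _ => [|x y px py|q qr]; first by rewrite dvdn1; case: eqP pP => // ->.
  by rewrite Euclid_dvdM // => /orP[].
by rewrite dvdn_prime2 // ?(allP rP q qr) // => /eqP pq; rewrite pq qr in pr.
Qed.

Lemma prime_dvd_fact p n : prime p -> p %| n`! -> p <= n.
Proof.
move=> pP; elim: n => [|n IH]; first by rewrite dvdn1; case: eqP pP => // ->.
by rewrite factS Euclid_dvdM // => /orP[/dvdn_leq->//|/IH/leqW].
Qed.

Lemma bin_odd_central_le m : 'C(m.*2.+1, m) <= 4 ^ m.
Proof.
have := expnDn 1 1 m.*2.+1; rewrite addn1 => E.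
rewrite -(@leq_pmul2l 2) // (_ : 2 * 4 ^ m = 2 ^ m.*2.+1); last first.
  by rewrite expnS -mul2n expnM.
rewrite E.
have mm : m < m.*2.+2 by lia.
have mm1 : m.+1 < m.*2.+2 by lia.
rewrite (bigD1 (Ordinal mm)) //= (bigD1 (Ordinal mm1)) /=; last first.
  by rewrite -val_eqE /=; lia.
rewrite !exp1n !muln1 addnA -[X in _ <= X + _](_ : 2 * 'C(m.*2.+1, m) = _) ?leq_addr //.
by rewrite mul2n -addnn; congr (_ + _); rewrite -bin_sub; [congr 'C(_, _)|]; lia.
Qed.

(** The primes in [(m + 1, 2 m + 1]] all divide [C(2 m + 1, m)]. *)
Lemma primorial_le n : primorial n <= 4 ^ n.
Proof.
elim/ltn_ind: n => n IH.
have [|n2] := leqP n 2.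
  by rewrite /primorial; case: n {IH} => [|[|[|n]]] // _; rewrite unlock.
have [nodd|neven] := boolP (odd n); last first.
  have nE : n = n.-1.+1 by lia.
  rewrite /primorial big_mkcond big_nat_recr //= -big_mkcond /= ifN ?muln1.
    by rewrite {1}nE; apply: leq_trans (IH n.-1 _) _; [lia | rewrite leq_exp2l //; lia].
  by apply/negP => /even_prime; lia.
pose m := n./2; have nE : n = m.*2.+1 by rewrite /m; lia.
have -> : primorial n = primorial m.+1 * \prod_(m.+2 <= p < n.+1 | prime p) p.
  by rewrite /primorial -big_cat_nat //; lia.
have -> : 4 ^ n = 4 ^ m.+1 * 4 ^ m by rewrite -expnD; congr (_ ^ _); lia.
rewrite leq_mul ?IH //; first by lia.
apply: leq_trans (bin_odd_central_le m); apply: dvdn_leq.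
  by rewrite bin_gt0; lia.
rewrite -big_filter; apply: prod_primes_dvd.
- by rewrite filter_uniq // iota_uniq.
- exact: filter_all.
apply/allP => p; rewrite mem_filter mem_index_iota => /andP[pP /andP[mp pn]].
have : p %| 'C(m.*2.+1, m) * (m`! * (m.*2.+1 - m)`!).
  rewrite bin_fact; last by lia.
  by apply: dvdn_fact; lia.
rewrite !Euclid_dvdM // => /or3P[//| |] /(prime_dvd_fact pP); lia.
Qed.

(** Each prime above [4 ^ E] contributes a factor of at least [4 ^ E] to the
    primorial. *)
Lemma count_prime_le E n : E * cnt prime n.+1 <= n + E * 4 ^ E.
Proof.
have [E0|E0] := posnP E; first by rewrite E0.
have [nE|En] := leqP n.+1 (4 ^ E).
  by rewrite (leq_trans _ (leq_addl _ _)) // leq_mul2l (leq_trans (cnt_leq _ _) nE) orbT.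
rewrite /cnt -(subnKC (ltnW En)) iotaD count_cat mulnDr addnC add0n.
rewrite leq_add ?leq_mul2l ?(cnt_leq prime) ?orbT //.
rewrite -(@leq_exp2l 4) // expnM; apply: leq_trans (primorial_le n).
rewrite /primorial (big_cat_nat (n := 4 ^ E)) //=; last exact: ltnW.
rewrite -[leqLHS]mul1n leq_mul //.
  rewrite big_seq_cond; apply: prodn_cond_gt0 => p /andP[_]; exact: prime_gt0.
rewrite -iter_muln_1 -big_const_seq big_seq_cond [leqRHS]big_seq_cond.
rewrite /index_iota; apply: leq_prod => p.
by rewrite mem_iota => /andP[/andP[]].
Qed.

End Primorial.

(** * Exceptional indices for one prime, and for all primes up to T *)

(** [T] stands for the integer part of [N ^ (1/4)]. *)
Definition exceptional (p T N : nat) : nat :=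
  cnt (fun n => divides_harmonic_num p (n %/ p ^ trunc_log p T)) N.+1.

Section Exceptional.
Variables (p : nat) (pP : prime p).
Notation J := (divides_harmonic_num p).

Lemma exceptional_le T N :
  exceptional p T N <=
    p ^ trunc_log p T * cnt J (N %/ p ^ trunc_log p T).+1.
Proof.
set P := p ^ _; have P0 : 0 < P by rewrite expn_gt0 prime_gt0.
apply: leq_trans (cnt_block (d := P) (Q := J) _ _ _) => [|m|m r rP].
- by apply: cnt_monotone; rewrite mulnC ltn_ceil.
- exact: cnt_leq.
- by rewrite -/P mulnC divnMDl // divn_small // addn0.
Qed.

(** With [P] the power of [p], [Y = N %/ P] and [k + 1] digits in [Y], the count
    is at most [P * (4 * K ^ k.+1 * Y ^ 2) ^ (1/3)], and
    [P * Y ^ (2/3) <= P ^ (1/3) * N ^ (2/3) <= N ^ (1/12 + 2/3)].  Twelfth powers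
    clear the exponents [1/3] and [1/4]. *)
Lemma exceptional_pow12 K T N :
  (forall m z, 0 < z <= p -> cnt (fun r => J (p * m + r)) z ^ 3 <= K * z ^ 2) ->
  0 < T -> T ^ 4 <= N ->
  exceptional p T N ^ 12 <=
    (4 * K) ^ 4 * K ^ (4 * trunc_log p (N %/ p ^ trunc_log p T)) * N ^ 9.
Proof.
set Y := N %/ _; move=> JK T0 TN; have p1 := prime_gt1 pP.
have PT := trunc_logP p1 T0.
have Y0 : 0 < Y.
  rewrite divn_gt0 ?expn_gt0 ?prime_gt0 //; apply: leq_trans PT (leq_trans _ TN).
  by rewrite -[leqLHS]expn1 leq_pexp2l.
have := cnt_cube pP JK (trunc_log_bounds p1 Y0).
have := exceptional_le T N; rewrite -/Y.
have : p ^ trunc_log p T * Y <= N by rewrite mulnC leq_divM.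
move: (exceptional _ _ _) (cnt _ _) (trunc_log p Y) => B c k PYN Bc c3.
have P4N : (p ^ trunc_log p T) ^ 4 <= N.
  by apply: leq_trans TN; rewrite leq_exp2r.
move: (p ^ _) PT PYN Bc P4N => P _ PYN Bc P4N.
apply: (@leq_trans ((P * c) ^ 12)); first by rewrite leq_exp2r.
rewrite expnMn -[c ^ 12]/(c ^ (3 * 4)) expnM.
apply: (@leq_trans (P ^ 12 * (4 * K ^ k.+1 * Y ^ 2) ^ 4)).
  by rewrite leq_mul2l leq_exp2r // c3 orbT.
have -> : P ^ 12 * (4 * K ^ k.+1 * Y ^ 2) ^ 4 =
    (4 * K) ^ 4 * K ^ (4 * k) * (P ^ 4 * (P * Y) ^ 8).
  by rewrite (mulnC 4 k) (expnM K) (expnS K k); ring.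
rewrite leq_mul2l; apply/orP; right.
by rewrite (expnS N 8) leq_mul // leq_exp2r.
Qed.

(** The quotient [N %/ p ^ trunc_log p T] is at least [T], hence has as many
    digits as desired once [T] is large. *)
Lemma exceptional_fixed E : exists T0, forall T N, T0 <= T -> T ^ 4 <= N ->
  E * exceptional p T N <= N.
Proof.
exists (p ^ (E * p ^ 2)) => T N T0 TN; have p1 := prime_gt1 pP.
have p0 := prime_gt0 pP.
have Tgt0 : 0 < T by apply: leq_trans T0; rewrite expn_gt0 p0.
have PT := trunc_logP p1 Tgt0.
have := exceptional_le T N.
have : p ^ trunc_log p T * (N %/ p ^ trunc_log p T) <= N by rewrite mulnC leq_divM.
have TY : T <= N %/ p ^ trunc_log p T.
  rewrite leq_divRL ?expn_gt0 ?p0 //; apply: leq_trans TN.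
  by apply: (@leq_trans (T * T)); [rewrite leq_mul2l PT orbT|rewrite mulnn leq_pexp2l].
move: (p ^ trunc_log p T) (N %/ _) TY => P Y TY PYN BPc.
have := cnt_sparse_log pP (trunc_log_bounds p1 (leq_trans Tgt0 TY)).
have : E * p ^ 2 <= trunc_log p Y.
  by apply: trunc_log_max => //; apply: leq_trans TY.
move: (trunc_log p Y) (cnt _ _) BPc => k c BPc Ek kc.
have Ec : E * c <= Y.
  rewrite -(@leq_pmul2l (p ^ 2)) ?expn_gt0 ?p0 //; apply: leq_trans kc.
  by rewrite mulnA (mulnC _ E) leq_mul2r Ek orbT.
apply: leq_trans PYN; apply: (@leq_trans (E * (P * c))).
  by rewrite leq_mul2l BPc orbT.
by rewrite mulnCA leq_mul2l Ec orbT.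
Qed.

End Exceptional.

Lemma cnt_block_cube_ex : exists2 K, 0 < K & forall p, prime p ->
  forall m z, 0 < z <= p ->
  cnt (fun r => divides_harmonic_num p (p * m + r)) z ^ 3 <= K * z ^ 2.
Proof. by exists 1000 => // p pP m z; exact: cnt_block_cube. Qed.

(** From [T < p ^ 2] one gets [N < p ^ 8], so the quotient has at most eight
    digits and the factor [K ^ (4 * k)] is bounded. *)
Lemma exceptional_large : exists C, forall p T N, prime p -> 0 < T -> T < p ^ 2 ->
  T ^ 4 <= N < T.+1 ^ 4 -> exceptional p T N <= C * T ^ 3.
Proof.
have [K K0 JK] := cnt_block_cube_ex.
(* The equation keeps this unary numeral from being computed. *)
have [c cE] : exists c, c = 16 ^ 9 by exists (16 ^ 9).
exists ((4 * K) ^ 4 * K ^ 28 * c) => p T N pP T0 Tp /andP[TN NT].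
have := exceptional_pow12 pP (JK p pP) T0 TN.
set k := trunc_log p _ => B12.
have p1 := prime_gt1 pP.
have k7 : k <= 7.
  rewrite -ltnS ltnNge; apply/negP => k8.
  have : p ^ 8 <= N.
    apply: leq_trans (leq_div N (p ^ trunc_log p T)).
    apply: leq_trans (trunc_logP p1 _); first by rewrite leq_exp2l.
    by case: posnP k8 => // Y0; rewrite /k Y0 trunc_log0.
  apply/negP; rewrite -ltnNge; apply: leq_trans NT _.
  by rewrite -[8]/(2 * 4) expnM leq_exp2r.
rewrite -(@leq_exp2r _ _ 12) //; apply: leq_trans B12 _.
have KK : K ^ (4 * k) <= K ^ 28 by rewrite leq_pexp2l //; lia.
have N9 : N ^ 9 <= c * T ^ 36.
  rewrite cE -[36]/(4 * 9) expnM -expnMn leq_exp2r // (leq_trans (ltnW NT)) //.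
  by rewrite -[16]/(2 ^ 4) -expnMn leq_exp2r //; lia.
apply: leq_trans (leq_mul (leq_mul (leqnn _) KK) N9) _.
rewrite mulnA (expnMn _ _ 12) -expnM leq_mul2r; apply/orP; right.
by move: (_ * c) => x; case: x => // x; rewrite -[leqLHS]expn1 leq_pexp2l.
Qed.

(** A prime [p >= K ^ 4] absorbs the constants: [K ^ (4 * k) <= p ^ k <= N]. *)
Lemma exceptional_middle : exists P0 C, forall p T N, prime p -> P0 <= p ->
  0 < T -> T ^ 4 <= N -> exceptional p T N ^ 12 <= C * N ^ 10.
Proof.
have [K K0 JK] := cnt_block_cube_ex.
exists (K ^ 4), ((4 * K) ^ 4) => p T N pP Kp T0 TN.
have p1 := prime_gt1 pP.
apply: leq_trans (exceptional_pow12 pP (JK p pP) T0 TN) _.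
rewrite -mulnA leq_mul2l; apply/orP; right; rewrite (expnS N 9) leq_mul2r.
apply/orP; right; rewrite expnM.
have N0 : 0 < N by apply: leq_trans TN; rewrite expn_gt0 T0.
set Y := N %/ _; have [->|Y0] := posnP Y; first by rewrite trunc_log0.
apply: leq_trans (leq_div N (p ^ trunc_log p T)).
apply: leq_trans (trunc_logP p1 Y0).
by case: (trunc_log p Y) => // k; rewrite leq_exp2r.
Qed.

Lemma leq_sum_average (I : eqType) (s : seq I) (P : pred I) (F : I -> nat) E N :
  (forall i, i \in s -> P i -> E * count P s * F i <= N) ->
  E * \sum_(i <- s | P i) F i <= N.
Proof.
have [c0 _|c0 H] := posnP (count P s).
  have -> : \sum_(i <- s | P i) F i = 0; last by rewrite muln0.
  rewrite -big_filter; move/eqP: c0; rewrite -size_filter size_eq0 => /eqP ->.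
  by rewrite big_nil.
rewrite -(@leq_pmul2l (count P s)) // mulnA big_distrr /=.
rewrite -[X in _ <= X * N]sum1_count big_distrl /= big_seq_cond [leqRHS]big_seq_cond.
by apply: leq_sum => i /andP[si Pi]; rewrite mul1n (mulnC _ E) H.
Qed.

Lemma sum_exceptional_fixed P0 E : exists T0, forall T N, T0 <= T ->
  T ^ 4 <= N ->
  E * \sum_(0 <= p < T.+1 | prime p && (p < P0)) exceptional p T N <= N.
Proof.
have [T0 H] : exists T0, forall p, prime p -> p < P0 -> forall T N, T0 <= T ->
    T ^ 4 <= N -> E * P0 * exceptional p T N <= N.
  elim: {-2}P0 => [|Q [T1 IH]]; first by exists 0.
  have [QP|/negP nQ] := boolP (prime Q); last first.
    exists T1 => p pP; rewrite ltnS leq_eqVlt => /orP[/eqP pQ|]; last exact: IH.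
    by case: nQ; rewrite -pQ.
  have [T2 H2] := exceptional_fixed QP (E * P0).
  exists (maxn T1 T2) => p pP pQ T N; rewrite geq_max => /andP[T1T T2T] TN.
  move: pQ; rewrite ltnS leq_eqVlt => /orP[/eqP ->|pQ]; first exact: H2.
  exact: (IH p pP pQ).
exists T0 => T N T0T TN; apply: leq_sum_average => p _ /andP[pP pP0].
apply: leq_trans (H p pP pP0 T N T0T TN).
rewrite leq_mul2r leq_mul2l; apply/orP; right; apply/orP; right.
apply: (@cnt_inj _ id T.+1 P0) => [n _ /andP[]//|a b /andP[ab _] _ _ /= E1].
by rewrite E1 ltnn in ab.
Qed.

(** There are at most [sqrt T] such primes, each with [O(N ^ (5/6))]
    exceptions. *)
Lemma sum_exceptional_middle : exists P0, forall E, exists T0, forall T N,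
  T0 <= T -> T ^ 4 <= N ->
  E * \sum_(0 <= p < T.+1 | [&& prime p, P0 <= p & p ^ 2 <= T])
        exceptional p T N <= N.
Proof.
have [P0 [C H]] := exceptional_middle; exists P0 => E.
exists (E ^ 12 * 4 ^ 6 * C).+1 => T N T0T TN.
have T0 : 0 < T by apply: leq_trans T0T.
apply: leq_sum_average => p _ /and3P[pP Pp _].
have := H p T N pP Pp T0 TN.
have : count (fun i => [&& prime i, P0 <= i & i ^ 2 <= T]) (index_iota 0 T.+1) ^ 2
    <= 4 * T.
  have [S /andP[ST TS]] := @root_ex 2 T isT.
  apply: (@leq_trans (S.+1 ^ 2)).
    rewrite leq_exp2r //.
    apply: (@cnt_inj _ id T.+1 S.+1) => [n _ /and3P[_ _ nT]|a b /andP[ab _] _ _ /= E1].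
      by rewrite -(@ltn_exp2r _ _ 2) // (leq_ltn_trans nT).
    by rewrite E1 ltnn in ab.
  have S0 : 0 < S by case: S TS {ST} => //; rewrite exp1n; lia.
  apply: (@leq_trans ((2 * S) ^ 2)); first by rewrite leq_exp2r //; lia.
  by rewrite expnMn leq_mul2l ST.
move: (count _ _) (exceptional _ _ _) => m B m2 B12.
rewrite -(@leq_exp2r _ _ 12) // !expnMn -[m ^ 12]/(m ^ (2 * 6)) expnM.
apply: (@leq_trans (E ^ 12 * (4 * T) ^ 6 * (C * N ^ 10))).
  by rewrite leq_mul // leq_mul2l leq_exp2r // m2 orbT.
have -> : E ^ 12 * (4 * T) ^ 6 * (C * N ^ 10) =
    (E ^ 12 * 4 ^ 6 * C) * T ^ 6 * N ^ 10 by rewrite expnMn; lia.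
rewrite -[N ^ 12]/(N ^ (2 + 10)) expnD leq_mul2r; apply/orP; right.
apply: (@leq_trans (T ^ 1 * T ^ 6)); first by rewrite expn1 leq_mul2r ltnW ?orbT.
rewrite -expnD; apply: (@leq_trans ((T ^ 4) ^ 2)); last by rewrite leq_exp2r.
by rewrite -expnM leq_pexp2l.
Qed.

(** Each such prime has [O(N ^ (3/4))] exceptions.  A bound by the number of all
    integers up to [T ~ N ^ (1/4)] would give only [O(N)]; the density zero of
    the primes is what makes the exponent [1/4] reachable. *)
Lemma sum_exceptional_large E : exists T0, forall T N, T0 <= T ->
  T ^ 4 <= N < T.+1 ^ 4 ->
  E * \sum_(0 <= p < T.+1 | prime p && (T < p ^ 2)) exceptional p T N <= N.
Proof.
have [C H] := exceptional_large.
(* Above [W] the error term of [count_prime_le] is at most [T]. *)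
have [W WE] : exists W, W = 2 * (E * C) * 4 ^ (2 * (E * C)) by eexists.
exists W.+1 => T N T0T TN.
have T0 : 0 < T by apply: leq_trans T0T.
apply: leq_sum_average => p _ /andP[pP Tp].
have Bp := H p T N pP T0 Tp TN.
have := count_prime_le (2 * (E * C)) T; rewrite -WE => pT.
have cp : count (fun i => prime i && (T < i ^ 2)) (index_iota 0 T.+1) <=
    cnt prime T.+1 by apply: (@leq_cnt _ prime T.+1) => n _ /andP[].
move: (count _ _) (exceptional _ _ _) Bp cp => m B Bp mp.
apply: leq_trans (leq_mul (leqnn _) Bp) _.
have EmC : E * C * m <= T.
  have : E * C * m <= E * C * cnt prime T.+1 by rewrite leq_mul2l mp orbT.
  by move: pT T0T; clear; rewrite -mulnA; lia.
case/andP: TN => TN _; apply: leq_trans TN; rewrite (expnS T 3).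
rewrite mulnA leq_mul2r; apply/orP; right.
by rewrite mulnAC.
Qed.

Lemma sum_exceptional_small E : exists T0, forall T N, T0 <= T ->
  T ^ 4 <= N < T.+1 ^ 4 ->
  E * \sum_(0 <= p < T.+1 | prime p) exceptional p T N <= N.
Proof.
have [P0 /(_ (3 * E)) [T2 H2]] := sum_exceptional_middle.
have [T1 H1] := sum_exceptional_fixed P0 (3 * E).
have [T3 H3] := sum_exceptional_large (3 * E).
exists (maxn T1 (maxn T2 T3)) => T N; rewrite !geq_max => /and3P[T1T T2T T3T] TN.
have /andP[TN4 _] := TN.
have := H1 T N T1T TN4; have := H2 T N T2T TN4; have := H3 T N T3T TN.
set S3 := \sum_(_ <= _ < _ | _) _; set S2 := \sum_(_ <= _ < _ | _) _.
set S1 := \sum_(_ <= _ < _ | _) _.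
have : \sum_(0 <= p < T.+1 | prime p) exceptional p T N <= S1 + S2 + S3.
  rewrite /S1 /S2 /S3 big_mkcond [X in X + _ + _]big_mkcond.
  rewrite [X in _ + X + _]big_mkcond [X in _ + _ + X]big_mkcond -!big_split /=.
  apply: leq_sum => p _; case: (prime p) => //=.
  case: (ltnP p P0) => ? /=; case: (leqP (p ^ 2) T) => ? /=; lia.
move: (\sum_(_ <= _ < _ | _) _) S1 S2 S3 => S S1 S2 S3; nia.
Qed.

(** * The asymptotic density *)

Lemma floor_root4_le (R : realType) n T : n < T.+1 ^ 4 -> floor_root4 R n <= T.
Proof.
move=> nT; rewrite -ltnS -(@ltn_exp2r _ _ 4) //; apply: leq_ltn_trans nT.
rewrite -(ler_nat R) natrX.
apply: (@le_trans _ _ (((n%:R : R) `^ 4^-1) ^+ 4)%R).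
  by rewrite lerXn2r ?nnegrE ?powR_ge0 // truncn_le // powR_ge0.
by rewrite -powR_mulrn ?powR_ge0 // -powRrM mulVf ?powRr1 ?pnatr_eq0.
Qed.

(** A prime power dividing some [k <= T] divides the largest power of that prime
    up to [T], which in turn divides the denominator. *)
Lemma mem_lcm_dvd_harmonic_den (R : realType) n T : 0 < n < T.+1 ^ 4 ->
  (forall p, prime p -> p <= T ->
     ~~ divides_harmonic_num p (n %/ p ^ trunc_log p T)) ->
  lcm_dvd_harmonic_den R n.
Proof.
move=> /andP[n0 nT] H; split => //.
rewrite dvdzE absz_nat /lcm_upto big_nat.
apply: (big_ind (fun x => x %| _)) => [||k /andP[k0 kr]]; first exact: dvd1n.
  by move=> a b; rewrite dvdn_lcm => -> ->.
have kT : k <= T by apply: leq_trans (floor_root4_le R nT).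
apply/(dvdn_partP _ k0) => p; rewrite mem_primes k0 => /and3P[pP _ pk].
have p1 := prime_gt1 pP.
have lT : logn p k <= trunc_log p T.
  apply: trunc_log_max => //; apply: leq_trans kT.
  by rewrite dvdn_leq // -p_part dvdn_part.
rewrite p_part; apply: dvdn_trans (dvdn_exp2l p lT) _.
have := H p pP (leq_trans (dvdn_leq k0 pk) kT).
case: (trunc_log p T) => [|j]; first by rewrite expn0 dvd1n.
by apply: contraNT => nd; apply: divides_harmonic_num_of_den.
Qed.

Lemma card_fset_set_cnt (R : realType) (A : set nat) (x : R) : (0 <= x)%R ->
  count_upto A x = cnt (fun n => `[< A n >] && (0 < n)) (Num.truncn x).+1.
Proof.
move=> x0; rewrite /count_upto /cnt -size_filter.
set s := seq.filter _ _.
have us : uniq s by rewrite filter_uniq // iota_uniq.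
rewrite -(undup_id us) -card_fseq.
congr (#|` _ |)%fset.
have nx n : (n%:R <= x)%R = (n < (Num.truncn x).+1) by rewrite -truncn_ge_nat // ltnS.
have sE n : (n \in s) <-> (A `&` [set n | (1 <= n)%N /\ (n%:R <= x)%R])%classic n.
  rewrite mem_filter mem_iota add0n leq0n /= -nx.
  split=> [/andP[/andP[/asboolP An n0] nN]|[/asboolP -> [-> ->]]] //.
have fin : finite_set (A `&` [set n | (1 <= n)%N /\ (n%:R <= x)%R])%classic.
  apply: (sub_finite_set _ (finite_II (Num.truncn x).+1)) => n [_ [_ /=]].
  by rewrite nx.
apply/fsetP => n; rewrite in_fset_set // inE /=; apply/idP/idP.
  by rewrite inE => /sE.
by move=> /sE ?; rewrite inE.
Qed.

Lemma count_upto_le (R : realType) (x : R) : (0 <= x)%R ->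
  count_upto (lcm_dvd_harmonic_den R) x <= Num.truncn x.
Proof.
move=> x0; rewrite card_fset_set_cnt //.
apply: (@cnt_inj _ predn) => [n nx /andP[_ n0]|a b /andP[ab _] /andP[_ a0] _]; lia.
Qed.

Lemma count_upto_ge (R : realType) (x : R) T : (0 <= x)%R ->
  Num.truncn x < T.+1 ^ 4 ->
  Num.truncn x <= count_upto (lcm_dvd_harmonic_den R) x +
    \sum_(0 <= p < T.+1 | prime p) exceptional p T (Num.truncn x).
Proof.
move=> x0; rewrite card_fset_set_cnt //; set N := Num.truncn x => NT.
rewrite -ltnS -[leqLHS](size_iota 0) -count_predT -addnS.
(* The index [0] is counted by [iota] but is not a positive integer; it is the
   [+ 1] that turns the bound for [N.+1] into one for [N]. *)
pose exc n := has (fun p => divides_harmonic_num p (n %/ p ^ trunc_log p T))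
                  [seq p <- index_iota 0 T.+1 | prime p].
set P := fun n => `[< _ >] && _.
apply: (@leq_trans (cnt (fun n => P n || ((n == 0) || exc n)) N.+1)).
  apply: (@leq_cnt predT (fun n => P n || ((n == 0) || exc n)) N.+1) => n nN _.
  have [->|n0] := posnP n; first by rewrite orbT.
  have [_|/hasPn nexc] := boolP (exc n); first by rewrite !orbT.
  rewrite /P n0 andbT; apply/orP; left; apply/asboolP.
  apply: (@mem_lcm_dvd_harmonic_den _ _ T) => [|p pP pT].
    by rewrite n0 (leq_trans nN).
  by apply: nexc; rewrite mem_filter pP mem_index_iota.
apply: leq_trans (cntU _ _ _) _; rewrite leq_add2l.
apply: leq_trans (cntU _ _ _) _; rewrite -[leqRHS]add1n leq_add //; last first.
  rewrite -[X in _ <= X](@big_filter _ _ _ _ _ prime).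
  exact: cnt_has.
apply: (@cnt_inj _ id) => [n _ /eqP ->|a b /andP[ab _] /eqP -> /eqP b0] //.
by rewrite b0 in ab.
Qed.

Unset Implicit Arguments.

Local Open Scope ring_scope.

Theorem theorem1p1 (R : realType) :
  has_asymptotic_density (lcm_dvd_harmonic_den R) (1 : R).
Proof.
apply/cvgrPdist_le => /= eps eps0.
pose E := (Num.truncn (2 / eps)).+1.
have E0 : 0 < E%:R :> R by rewrite ltr0n.
have Eeps : E%:R^-1 <= eps / 2.
  rewrite -[eps / 2]invrK lef_pV2 ?posrE ?invr_gt0 ?divr_gt0 // invf_div.
  by apply/ltW; rewrite -truncn_lt_nat ?divr_ge0 // ltW.
have [T0 HT] := sum_exceptional_small E.
near=> x.
have x0 : 0 < x by near: x; apply: nbhs_pinfty_gt.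
have xeps : 2 / eps <= x by near: x; apply: nbhs_pinfty_ge; exact: num_real.
have xT : (T0 ^ 4)%N%:R <= x by near: x; apply: nbhs_pinfty_ge; exact: num_real.
have [T TN] := @root_ex 4 (Num.truncn x) isT.
have T0T : (T0 <= T)%N.
  rewrite -ltnS -(@ltn_exp2r _ _ 4) //; case/andP: TN => _; apply: leq_ltn_trans.
  by rewrite truncn_ge_nat // ltW.
have bad := HT T _ T0T TN.
have [_ NT] := andP TN.
have := count_upto_ge (ltW x0) NT; have := count_upto_le (ltW x0).
move: bad; set S := (\sum_(_ <= _ < _ | _) _)%N; set c := count_upto _ _.
have /andP[] := truncn_itv (ltW x0); set N := Num.truncn x.
rewrite -addn1 natrD => Nx xN; rewrite -!(ler_nat R) natrM natrD => bad cN Nc.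
have SE : S%:R <= x / E%:R by rewrite ler_pdivlMr // mulrC (le_trans bad).
have -> : 1 - c%:R / x = (x - c%:R) / x by rewrite mulrBl divff ?gt_eqF.
rewrite normrM normfV (gtr0_norm x0) ger0_norm ?subr_ge0 ?(le_trans cN) //.
rewrite ler_pdivrMr //.
have x1 : 1 <= eps / 2 * x.
  by rewrite mulrC -ler_pdivrMr ?divr_gt0 // mul1r invf_div.
have : x / E%:R <= eps / 2 * x by rewrite mulrC ler_pM2r.
have -> : eps * x = eps / 2 * x + eps / 2 * x by rewrite -mulrDl -splitr.
move: (eps / 2 * x) x1 => y y1 xy.
lra.
Unshelve. all: by end_near.
Qed.
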